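(* Let $\mathbb B=(A,\prec_1,\prec_2)$ be a bi-subordination algebra, and for $i=1,2$ let $\Diamond_i a=\bigwedge\{b\in A\mid a\prec_i b\}$ and $\blacksquare_i a=\bigvee\{b\in A\mid b\prec_i a\}$ in $A^\delta$, extended to $A^\delta$ as $\Diamond_i^\sigma$, $\blacksquare_i^\pi$ (superscripts omitted). Inequalities are in $A^\delta$, with $a,b$ ranging over $A$. 1. $\prec_1\,\subseteq\,\prec_2$ iff $\Diamond_2a\le\Diamond_1a$ for all $a$. 2. $\prec_2\circ\prec_1\,\subseteq\,\le$ iff $\blacksquare_2a\le\Diamond_1a$ for all $a$. 3. If $A$ is a distributive lattice, then (i) (P1) holds iff $\blacksquare_1(a\vee b)\le\Diamond_2a\vee\blacksquare_1b$ for all $a,b$; (ii) (P2) holds iff $\blacksquare_1a\wedge\Diamond_2b\le\Diamond_2(a\wedge b)$ for all $a,b$. 4. $\prec_2\circ\prec_1\,\subseteq\,\prec_1\circ\prec_2$ iff $\Diamond_1\blacksquare_2a\le\blacksquare_2\Diamond_1a$ for all $a$. 5. $\prec_1\circ\prec_2\,\subseteq\,\prec_1$ iff $\Diamond_1a\le\Diamond_2\Diamond_1a$ for all $a$. 6. $\forall a\forall b\,(a\prec_1b\ \&\ a\prec_2b\Rightarrow b=\top)$ iff $\Diamond_1a\vee\Diamond_2a=\top$ for all $a$. 7. $\forall b\,(\forall a(a\prec_1b)\Rightarrow\forall a(a\prec_2b))$ iff $\Diamond_2\top\le\Diamond_1\top$. 8. $\forall a\,(\exists b(a\prec_1b\ \&\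 b\prec_2\bot)\Rightarrow a=\bot)$ iff $\blacksquare_1\blacksquare_2\bot=\bot$.
   Context: Canonical extension. For a poset $A$, $A^\delta$ is a complete lattice containing $A$ as a subposet. $k\in A^\delta$ is closed ($k\in K(A^\delta)$) if $k=\bigwedge F$ for some nonempty down-directed $F\subseteq A$; $o$ is open ($o\in O(A^\delta)$) if $o=\bigvee I$ for some nonempty up-directed $I\subseteq A$. Denseness: every element of $A^\delta$ is a join of closed elements and a meet of open elements. Compactness: if $F\subseteq A$ is nonempty down-directed, $I\subseteq A$ nonempty up-directed and $\bigwedge F\le\bigvee I$, then $a\le b$ for some $a\in F$, $b\in I$. $A^\delta$ exists and is unique up to isomorphism fixing $A$. A subordination algebra is a pair $(A,\prec)$ with $A$ a bounded lattice and $\prec\,\subseteq A\times A$ such that $\bot\prec\bot$; $\top\prec\top$; (SI) $a\le b\prec x\Rightarrow a\prec x$; (WO) $b\prec x\le y\Rightarrow b\prec y$; (AND) $a\prec x\ \&\ a\prec y\Rightarrow a\prec x\wedge y$; (OR) $a\prec x\ \&\ b\prec x\Rightarrow a\vee b\prec x$. A bi-subordination algebra is $(A,\prec_1,\prec_2)$ with both $(A,\prec_1)$ and $(A,\prec_2)$ subordination algebras. Extensions: $\Diamond^\sigma k=\bigwedge\{\Diamond a\mid a\in A,k\le a\}$ for $k$ closed, $\Diamond^\sigma u=\bigvee\{\Diamond^\sigma k\mid k\in K(A^\delta),k\le u\}$; $\blacksquare^\pi o=\bigvee\{\blacksquare a\mid a\in A,a\le o\}$ for $o$ open, $\blacksquare^\pi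 u=\bigwedge\{\blacksquare^\pi o\mid o\in O(A^\delta),u\le o\}$. Composition is read left to right: $x\,(R\circ S)\,y$ iff $x\,R\,z$ and $z\,S\,y$ for some $z\in A$. (P1) For all $a,b,c$: $c\prec_1a\vee b\Rightarrow\forall d[a\prec_2d\Rightarrow\exists e(e\prec_1b\ \&\ c\le e\vee d)]$. (P2) For all $a,b,c$: $a\wedge b\prec_2c\Rightarrow\forall d[d\prec_1a\Rightarrow\exists e(b\prec_2e\ \&\ d\wedge e\le c)]$. *)

(* Defs.v *)
From mathcomp Require Import all_boot all_order.
From mathcomp Require Import boolp classical_sets.

Set Implicit Arguments.
Unset Strict Implicit.
Unset Printing Implicit Defensive.

Import Order.TTheory.
Local Open Scope order_scope.
Local Open Scope classical_set_scope.

Section CompleteLattice.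
Context {d : Order.disp_t} {D : tbLatticeType d}.
Implicit Type S : set D.

(* [supremum x0 set0] and [infimum x0 set0] are [x0], hence the choice of the
   default values. *)
Definition bigjoin S : D := supremum \bot S.
Definition bigmeet S : D := infimum \top S.

End CompleteLattice.

Definition complete_lattice {d : Order.disp_t} (D : tbLatticeType d) : Prop :=
  forall S : set D, supremums S !=set0 /\ infimums S !=set0.

Section Directed.
Context {d : Order.disp_t} {A : porderType d}.

Definition up_directed (S : set A) : Prop :=
  forall x y, S x -> S y -> exists z, [/\ S z, x <= z & y <= z].

Definition down_directed (S : set A) : Prop :=
  forall x y, S x -> S y -> exists z, [/\ S z, z <= x & z <= y].

End Directed.

Section CanonicalExtension.
Context {d d' : Order.disp_t} {A : porderType d} {D : tbLatticeType d'}.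
Variable e : A -> D.

Definition closed_elt (k : D) : Prop :=
  exists F : set A, [/\ F !=set0, down_directed F & k = bigmeet (e @` F)].

Definition open_elt (o : D) : Prop :=
  exists I : set A, [/\ I !=set0, up_directed I & o = bigjoin (e @` I)].

(* D is a canonical extension of A, the inclusion of A in D being e. *)
Record canonical_extension : Prop := CanonicalExtension {
  canext_complete : complete_lattice D;
  canext_embedding : {mono e : x y / x <= y};
  canext_dense_closed : forall u : D,
    exists2 S : set D, S `<=` closed_elt & u = bigjoin S;
  canext_dense_open : forall u : D,
    exists2 S : set D, S `<=` open_elt & u = bigmeet S;
  canext_compact : forall F I : set A,
    F !=set0 -> down_directed F -> I !=set0 -> up_directed I ->
    bigmeet (e @` F) <= bigjoin (e @` I) ->
    exists a b, [/\ F a, I b & a <= b]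
}.

Definition sigma_closed (f : A -> D) (k : D) : D :=
  bigmeet [set f a | a in [set a | k <= e a]].

Definition sigma_ext (f : A -> D) (u : D) : D :=
  bigjoin [set sigma_closed f k | k in [set k | closed_elt k /\ k <= u]].

Definition pi_open (f : A -> D) (o : D) : D :=
  bigjoin [set f a | a in [set a | e a <= o]].

Definition pi_ext (f : A -> D) (u : D) : D :=
  bigmeet [set pi_open f o | o in [set o | open_elt o /\ u <= o]].

End CanonicalExtension.

Record subordination {d : Order.disp_t} {A : tbLatticeType d}
    (prec : A -> A -> Prop) : Prop := Subordination {
  sub_bot : prec \bot \bot;
  sub_top : prec \top \top;
  sub_SI : forall a b x, a <= b -> prec b x -> prec a x;
  sub_WO : forall b x y, prec b x -> x <= y -> prec b y;
  sub_AND : forall a x y, prec a x -> prec a y -> prec a (x `&` y)%O;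
  sub_OR : forall a b x, prec a x -> prec b x -> prec (a `|` b)%O x
}.

Definition bisubordination {d : Order.disp_t} {A : tbLatticeType d}
    (prec1 prec2 : A -> A -> Prop) : Prop :=
  subordination prec1 /\ subordination prec2.

Section SubordinationOperators.
Context {d d' : Order.disp_t} {A : tbLatticeType d} {D : tbLatticeType d'}.
Variables (e : A -> D) (prec : A -> A -> Prop).

Definition dia (a : A) : D := bigmeet [set e b | b in [set b | prec a b]].
Definition box (a : A) : D := bigjoin [set e b | b in [set b | prec b a]].

Definition diaS : D -> D := sigma_ext e dia.
Definition boxP : D -> D := pi_ext e box.

End SubordinationOperators.

Definition rel_sub {T : Type} (R S : T -> T -> Prop) : Prop :=
  forall x y, R x y -> S x y.

(* Left to right: first R, then S. *)
Definition rel_comp {T : Type} (R S : T -> T -> Prop) : T -> T -> Prop :=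
  fun x y => exists2 z, R x z & S z y.

Section Conditions.
Context {d : Order.disp_t} {A : tbLatticeType d}.
Variables prec1 prec2 : A -> A -> Prop.

Definition P1 : Prop := forall a b c : A,
  prec1 c (a `|` b)%O ->
  forall x, prec2 a x -> exists y, prec1 y b /\ c <= (y `|` x)%O.

Definition P2 : Prop := forall a b c : A,
  prec2 (a `&` b)%O c ->
  forall x, prec1 x a -> exists y, prec2 b y /\ (x `&` y)%O <= c.

End Conditions.

Section Agreement.
Context {d d' : Order.disp_t} {A : tbLatticeType d} {D : tbLatticeType d'}.
Variables (e : A -> D) (prec : A -> A -> Prop).
Hypothesis De : canonical_extension e.
Hypothesis subA : subordination prec.

Lemma bigjoinP (S : set D) : supremums S (bigjoin S).
Proof.
rewrite /bigjoin /supremum; case: ifPn => [/eqP ->|_].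
  by split=> [x []|x _]; rewrite ?le0x.
by have [[x Sx] _] := canext_complete De S; apply: (xgetPex _ (ex_intro _ x Sx)).
Qed.

Lemma bigmeetP (S : set D) : infimums S (bigmeet S).
Proof.
rewrite /bigmeet /infimum; case: ifPn => [/eqP ->|_].
  by split=> [x []|x _]; rewrite ?lex1.
by have [_ [x Sx]] := canext_complete De S; apply: (xgetPex _ (ex_intro _ x Sx)).
Qed.

Lemma closed_elt_incl a : closed_elt e (e a).
Proof.
exists [set a]; split; first by exists a.
  by move=> x y -> ->; exists a.
rewrite image_set1 /bigmeet /infimum ifF; last by apply/negbTE/set0P; exists (e a).
by rewrite infimums1; case: xgetP => // /(_ (e a)) /(_ erefl).
Qed.

Lemma open_elt_incl a : open_elt e (e a).
Proof.
exists [set a]; split; first by exists a.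
  by move=> x y -> ->; exists a.
by rewrite image_set1 /bigjoin supremum1.
Qed.

(* The general clauses of the extensions agree with the restricted ones on
   closed (resp. open) elements, and with the original maps on A. *)
Lemma sigma_ext_closed (f : A -> D) k :
  closed_elt e k -> sigma_ext e f k = sigma_closed e f k.
Proof.
move=> kc; have [ub lub] := bigjoinP
  [set sigma_closed e f j | j in [set j | closed_elt e j /\ j <= k]].
apply/le_anti/andP; split; last by apply: ub; exists k.
apply: lub => _ [j [_ jk] <-].
have [lb _] := bigmeetP [set f a | a in [set a | j <= e a]].
have [_ glb] := bigmeetP [set f a | a in [set a | k <= e a]].
by apply: glb => _ [a ka <-]; apply: lb; exists a => //=; apply: le_trans ka.
Qed.

Lemma pi_ext_open (f : A -> D) o :
  open_elt e o -> pi_ext e f o = pi_open e f o.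
Proof.
move=> oo; have [lb glb] := bigmeetP
  [set pi_open e f j | j in [set j | open_elt e j /\ o <= j]].
apply/le_anti/andP; split; first by apply: lb; exists o.
apply: glb => _ [j [_ oj] <-].
have [ub _] := bigjoinP [set f a | a in [set a | e a <= j]].
have [_ lub] := bigjoinP [set f a | a in [set a | e a <= o]].
by apply: lub => _ [a ao <-]; apply: ub; exists a => //=; apply: le_trans oj.
Qed.

Lemma diaS_incl a : diaS e prec (e a) = dia e prec a.
Proof.
rewrite /diaS (sigma_ext_closed _ (closed_elt_incl a)).
have [lb glb] := bigmeetP [set dia e prec b | b in [set b | e a <= e b]].
apply/le_anti/andP; split; first by apply: lb; exists a => /=.
apply: glb => _ [b /= ab <-]; rewrite (canext_embedding De) in ab.
have [lba _] := bigmeetP [set e c | c in [set c | prec a c]].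
have [_ glbb] := bigmeetP [set e c | c in [set c | prec b c]].
by apply: glbb => _ [c /= bc <-]; apply: lba; exists c => //=; apply: sub_SI bc.
Qed.

Lemma boxP_incl a : boxP e prec (e a) = box e prec a.
Proof.
rewrite /boxP (pi_ext_open _ (open_elt_incl a)).
have [ub lub] := bigjoinP [set box e prec b | b in [set b | e b <= e a]].
apply/le_anti/andP; split; last by apply: ub; exists a => /=.
apply: lub => _ [b /= ba <-]; rewrite (canext_embedding De) in ba.
have [uba _] := bigjoinP [set e c | c in [set c | prec c a]].
have [_ lubb] := bigjoinP [set e c | c in [set c | prec c b]].
by apply: lubb => _ [c /= cb <-]; apply: uba; exists c => //=; apply: sub_WO ba.
Qed.

End Agreement.

(* Main.v *)
Require Import Defs.
From mathcomp Require Import all_boot all_order.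
From mathcomp Require Import boolp classical_sets.
Local Open Scope order_scope.

(** By compactness, [dia a <= o] with [o] open means [a prec b] and [e b <= o]
for some [b], and [k <= box a] with [k] closed means [k <= e b] and [b prec a]
for some [b]. By denseness, an inequality [u <= v] in the canonical extension
may be tested on closed elements below [u] and on open elements above [v].
Each correspondence is then a translation between the two sides; item 3 also uses
that the embedding preserves binary joins and meets. *)

Set Implicit Arguments.
Unset Strict Implicit.
Import Order.TTheory.

(* Both scopes define [`|`] and [`&`]; reopening [order_scope] last makes them
lattice operations. *)
Local Open Scope classical_set_scope.
Local Open Scope order_scope.

Section CanonicalExtensionTheory.
Context {d d' : Order.disp_t} {A : tbLatticeType d} {D : tbLatticeType d'}.
Variable e : A -> D.
Hypothesis He : canonical_extension e.
Implicit Types (S : set D) (F I : set A) (a b : A) (k o u v : D).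

(** * Bounds, compactness and denseness *)

Lemma bigjoin_ub S u : S u -> u <= bigjoin S.
Proof. by have [ub _] := bigjoinP He S; apply: ub. Qed.

Lemma bigjoin_le S v : (forall u, S u -> u <= v) -> bigjoin S <= v.
Proof. by move=> Sv; have [_ lub] := bigjoinP He S; apply: lub. Qed.

Lemma bigmeet_lb S u : S u -> bigmeet S <= u.
Proof. by have [lb _] := bigmeetP He S; apply: lb. Qed.

Lemma le_bigmeet S v : (forall u, S u -> v <= u) -> v <= bigmeet S.
Proof. by move=> Sv; have [_ glb] := bigmeetP He S; apply: glb. Qed.

(** Write [k] as a meet over [F]: compactness yields [a] in [F] and [i] in [I] with [a <= i], and
    [k] is below [e a]. *)
Lemma closed_le_bigjoin k I : closed_elt e k -> I !=set0 -> up_directed I ->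
  k <= bigjoin (e @` I) -> exists2 i, I i & k <= e i.
Proof.
move=> [F [F0 dF ->]] I0 uI /(canext_compact He F0 dF I0 uI) [a [i [Fa Ii ai]]].
exists i => //; apply: (@le_trans _ _ (e a)); last by rewrite (canext_embedding He).
by apply: bigmeet_lb; exists a.
Qed.

Lemma bigmeet_le_open o F : open_elt e o -> F !=set0 -> down_directed F ->
  bigmeet (e @` F) <= o -> exists2 a, F a & e a <= o.
Proof.
move=> [I [I0 uI ->]] F0 dF /(canext_compact He F0 dF I0 uI) [a [i [Fa Ii ai]]].
exists a => //; apply: (@le_trans _ _ (e i)); first by rewrite (canext_embedding He).
by apply: bigjoin_ub; exists i.
Qed.

(** [v] is a meet of open elements, each of them above [v] and so, by assumption, above [u]. *)
Lemma le_opens u v : (forall o, open_elt e o -> v <= o -> u <= o) -> u <= v.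
Proof.
have [S So ->] := canext_dense_open He v => uo.
apply: le_bigmeet => o o_S; apply: uo; first exact: So.
exact: bigmeet_lb.
Qed.

Lemma closeds_le u v : (forall k, closed_elt e k -> k <= u -> k <= v) -> u <= v.
Proof.
have [S Sk ->] := canext_dense_closed He u => kv.
apply: bigjoin_le => k k_S; apply: kv; first exact: Sk.
exact: bigjoin_ub.
Qed.

(** * Preservation of the lattice operations and bounds by the embedding *)

Lemma canext_join a b : e (a `|` b) = e a `|` e b.
Proof.
apply/le_anti/andP; split; last first.
  by rewrite leUx !(canext_embedding He) leUl leUr.
(* An open element above [e a] and [e b] already has members of [I] above [a] and [b]; directedness
   merges them into one member above both. *)
apply: le_opens => _ [I [I0 uI ->]]; rewrite leUx => /andP[aI bI].
have [i Ii] := closed_le_bigjoin (closed_elt_incl e a) I0 uI aI.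
have [j Ij] := closed_le_bigjoin (closed_elt_incl e b) I0 uI bI.
rewrite !(canext_embedding He) => bj ai.
have [l [Il il jl]] := uI _ _ Ii Ij.
apply: (@le_trans _ _ (e l)); last by apply: bigjoin_ub; exists l.
by rewrite (canext_embedding He) leUx (le_trans ai il) (le_trans bj jl).
Qed.

Lemma canext_meet a b : e (a `&` b) = e a `&` e b.
Proof.
apply/le_anti/andP; split.
  by rewrite lexI !(canext_embedding He) leIl leIr.
apply: closeds_le => _ [F [F0 dF ->]]; rewrite lexI => /andP[Fa Fb].
have [i Fi] := bigmeet_le_open (open_elt_incl e a) F0 dF Fa.
have [j Fj] := bigmeet_le_open (open_elt_incl e b) F0 dF Fb.
rewrite !(canext_embedding He) => jb ia.
have [l [Fl li lj]] := dF _ _ Fi Fj.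
apply: (@le_trans _ _ (e l)); first by apply: bigmeet_lb; exists l.
by rewrite (canext_embedding He) lexI (le_trans li ia) (le_trans lj jb).
Qed.

Lemma canext_bot : e \bot = \bot.
Proof.
(* Nonemptiness of [I] puts [e \bot] below every open element. *)
apply/le_anti; rewrite le0x andbT; apply: le_opens => _ [I [[i Ii] _ ->]] _.
apply: (@le_trans _ _ (e i)); first by rewrite (canext_embedding He) le0x.
by apply: bigjoin_ub; exists i.
Qed.

Lemma canext_top : e \top = \top.
Proof.
apply/le_anti; rewrite lex1 /=; apply: closeds_le => _ [F [[i Fi] _ ->]] _.
apply: (@le_trans _ _ (e i)); last by rewrite (canext_embedding He) lex1.
by apply: bigmeet_lb; exists i.
Qed.

(** * The operators of a single subordination *)

Section Operators.
Variable prec : A -> A -> Prop.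
Hypothesis Hprec : subordination prec.

(** Nonemptiness and directedness of the sets of successors and of predecessors make [dia e prec a]
    closed and [box e prec a] open. *)
Let up_nonempty a : [set b | prec a b] !=set0.
Proof. by exists \top; apply: (sub_SI Hprec (lex1 a)); exact: sub_top. Qed.

Let up_down_directed a : down_directed [set b | prec a b].
Proof.
move=> x y /= ax ay; exists (x `&` y); split; [|exact: leIl|exact: leIr].
exact: (sub_AND Hprec).
Qed.

Let down_nonempty a : [set b | prec b a] !=set0.
Proof. by exists \bot; apply: (sub_WO Hprec) (le0x a); exact: sub_bot. Qed.

Let down_up_directed a : up_directed [set b | prec b a].
Proof.
move=> x y /= xa ya; exists (x `|` y); split; [|exact: leUl|exact: leUr].
exact: (sub_OR Hprec).
Qed.

Lemma dia_closed a : closed_elt e (dia e prec a).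
Proof. by exists [set b | prec a b]; split. Qed.

Lemma box_open a : open_elt e (box e prec a).
Proof. by exists [set b | prec b a]; split. Qed.

Lemma dia_le_open a o : open_elt e o -> dia e prec a <= o ->
  exists2 b, prec a b & e b <= o.
Proof. by move=> oo; apply: bigmeet_le_open. Qed.

Lemma closed_le_box k a : closed_elt e k -> k <= box e prec a ->
  exists2 b, prec b a & k <= e b.
Proof. by move=> kc; apply: closed_le_bigjoin. Qed.

(** Compactness gives a successor of [a] below [b], and (WO) moves it up to [b]. With its dual
    [le_boxP], this recovers the relation from the operators. *)
Lemma dia_leP a b : dia e prec a <= e b <-> prec a b.
Proof.
split=> [/(dia_le_open (open_elt_incl e b)) [c ac]|ab].
  by rewrite (canext_embedding He); apply: sub_WO.
by apply: bigmeet_lb; exists b.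
Qed.

Lemma le_boxP a b : e b <= box e prec a <-> prec b a.
Proof.
split=> [/(closed_le_box (closed_elt_incl e b)) [c ca]|ba].
  by rewrite (canext_embedding He) => /(sub_SI Hprec); apply.
by apply: bigjoin_ub; exists b.
Qed.

Lemma le_diaP a v : v <= dia e prec a <-> forall b, prec a b -> v <= e b.
Proof.
split=> [va b /dia_leP|vb]; first exact: le_trans.
by apply: le_bigmeet => _ [b ab <-]; apply: vb.
Qed.

Lemma box_leP a v : box e prec a <= v <-> forall b, prec b a -> e b <= v.
Proof.
split=> [av b /le_boxP ba|bv]; first exact: le_trans av.
by apply: bigjoin_le => _ [b ba <-]; apply: bv.
Qed.

(** [e a] is closed, hence one of the indices of the join defining [diaS e prec u]. *)
Lemma dia_le_diaS a u : e a <= u -> dia e prec a <= diaS e prec u.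
Proof.
move=> au; rewrite -(diaS_incl He Hprec) /diaS.
rewrite (sigma_ext_closed He _ (closed_elt_incl e a)).
by apply: bigjoin_ub; exists (e a) => //; split=> //; apply: closed_elt_incl.
Qed.

Lemma boxP_le_box a u : u <= e a -> boxP e prec u <= box e prec a.
Proof.
move=> ua; rewrite -(boxP_incl He Hprec) /boxP.
rewrite (pi_ext_open He _ (open_elt_incl e a)).
by apply: bigmeet_lb; exists (e a) => //; split=> //; apply: open_elt_incl.
Qed.

(** At a closed [k] the outer join of the extension collapses, leaving a single meet. *)
Lemma le_diaS_closed k v : closed_elt e k ->
  v <= diaS e prec k <-> forall b, k <= e b -> v <= dia e prec b.
Proof.
move=> kc; rewrite /diaS (sigma_ext_closed He _ kc); split=> [vk b kb|vb].
  by apply: le_trans vk _; apply: bigmeet_lb; exists b.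
by apply: le_bigmeet => _ [b kb <-]; apply: vb.
Qed.

Lemma boxP_open_le o v : open_elt e o ->
  boxP e prec o <= v <-> forall b, e b <= o -> box e prec b <= v.
Proof.
move=> oo; rewrite /boxP (pi_ext_open He _ oo); split=> [ov b bo|bv].
  by apply: le_trans ov; apply: bigjoin_ub; exists b.
by apply: bigjoin_le => _ [b bo <-]; apply: bv.
Qed.

(** Each term of the join defining [diaS e prec u] is a meet, so one member of that meet below [v]
    is enough. *)
Lemma diaS_le u v : (forall k, closed_elt e k -> k <= u ->
  exists2 b, k <= e b & dia e prec b <= v) -> diaS e prec u <= v.
Proof.
move=> uv; apply: bigjoin_le => _ [k [kc ku] <-]; have [b kb] := uv k kc ku.
by apply: le_trans; apply: bigmeet_lb; exists b.
Qed.

Lemma le_boxP_ext u v : (forall o, open_elt e o -> u <= o ->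
  exists2 b, e b <= o & v <= box e prec b) -> v <= boxP e prec u.
Proof.
move=> uv; apply: le_bigmeet => _ [o [oo uo] <-]; have [b bo] := uv o oo uo.
by move/le_trans; apply; apply: bigjoin_ub; exists b.
Qed.

(** Joining a fixed [a] to every predecessor of [b] keeps the family directed and inside [A], so
    compactness applies to the whole right-hand side. *)
Lemma le_join_box a b c :
  e c <= e a `|` box e prec b -> exists2 y, prec y b & c <= y `|` a.
Proof.
move=> cab; pose I := [set y `|` a | y in [set y | prec y b]].
have I0 : I !=set0 by have [y yb] := down_nonempty b; exists (y `|` a); exists y.
have uI : up_directed I.
  move=> _ _ [x xb <-] [y yb <-]; have [z [zb xz yz]] := down_up_directed xb yb.
  by exists (z `|` a); split; rewrite ?leU2 //; exists z.
suff /(closed_le_bigjoin (closed_elt_incl e c) I0 uI) :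
    e c <= bigjoin (e @` I).
  by move=> [_ [y yb <-]]; rewrite (canext_embedding He); exists y.
apply: le_trans cab _; have ub y : prec y b -> e (y `|` a) <= bigjoin (e @` I).
  by move=> yb; apply: bigjoin_ub; exists (y `|` a) => //; exists y.
rewrite leUx; apply/andP; split.
  (* Some predecessor of [b] must exist for [e a] to lie below the join. *)
  have [y /ub] := down_nonempty b; apply: le_trans.
  by rewrite (canext_embedding He) leUr.
apply/box_leP => y /ub; apply: le_trans.
by rewrite (canext_embedding He) leUl.
Qed.

Lemma meet_dia_le a b c :
  e a `&` dia e prec b <= e c -> exists2 y, prec b y & a `&` y <= c.
Proof.
move=> abc; pose F := [set a `&` y | y in [set y | prec b y]].
have F0 : F !=set0 by have [y yb] := up_nonempty b; exists (a `&` y); exists y.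
have dF : down_directed F.
  move=> _ _ [x xb <-] [y yb <-]; have [z [zb xz yz]] := up_down_directed xb yb.
  by exists (a `&` z); split; rewrite ?leI2 //; exists z.
suff /(bigmeet_le_open (open_elt_incl e c) F0 dF) : bigmeet (e @` F) <= e c.
  by move=> [_ [y yb <-]]; rewrite (canext_embedding He); exists y.
apply: le_trans abc; have lb y : prec b y -> bigmeet (e @` F) <= e (a `&` y).
  by move=> yb; apply: bigmeet_lb; exists (a `&` y) => //; exists y.
rewrite lexI; apply/andP; split.
  have [y /lb /le_trans] := up_nonempty b; apply.
  by rewrite (canext_embedding He) leIl.
apply/le_diaP => y /lb /le_trans; apply.
by rewrite (canext_embedding He) leIr.
Qed.

End Operators.

(** * The correspondences between relations and inequalities *)

Section Correspondences.
Variables prec1 prec2 : A -> A -> Prop.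
Hypotheses (H1 : subordination prec1) (H2 : subordination prec2).

Lemma rel_sub_correspondence : rel_sub prec1 prec2 <->
  forall a, dia e prec2 a <= dia e prec1 a.
Proof.
split=> [sub a|le12 a b /(dia_leP H1) ab].
  by apply/(le_diaP H1) => b /sub /(dia_leP H2).
by apply/(dia_leP H2); apply: le_trans ab.
Qed.

Lemma comp_sub_le_correspondence :
  rel_sub (rel_comp prec2 prec1) (fun x y : A => x <= y) <->
  forall a, box e prec2 a <= dia e prec1 a.
Proof.
split=> [sub a|le21 a b [c /(le_boxP H2) ac /(dia_leP H1) cb]].
  apply/(box_leP H2) => b ba; apply/(le_diaP H1) => c ac.
  by rewrite (canext_embedding He); apply: sub; exists a.
by rewrite -(canext_embedding He) (le_trans ac) // (le_trans (le21 c)).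
Qed.

Lemma P1_correspondence : P1 prec1 prec2 <->
  forall a b, box e prec1 (a `|` b) <= dia e prec2 a `|` box e prec1 b.
Proof.
split=> [p1 a b|le12 a b c /(le_boxP H1) cab x /(dia_leP H2) ax].
  (* An open [o] above the right-hand side is above [dia e prec2 a], which supplies the [x] to feed
     to [P1]. *)
  apply/(box_leP H1) => c cab; apply: le_opens => o oo.
  rewrite leUx => /andP[/(dia_le_open H2 oo) [x ax xo] bo].
  have [y [/(le_boxP H1) yb cyx]] := p1 a b c cab x ax.
  apply: (@le_trans _ _ (e (y `|` x))); first by rewrite (canext_embedding He).
  by rewrite canext_join leUx xo (le_trans yb bo).
(* Since [dia e prec2 a <= e x], the inequality still bounds [e c] once [dia e prec2 a] is replaced
   by [e x]. *)
have [|y yb cyx] := @le_join_box _ H1 x b c; last by exists y.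
by apply: le_trans cab (le_trans (le12 a b) _); apply: leU2.
Qed.

Lemma P2_correspondence : P2 prec1 prec2 <->
  forall a b, box e prec1 a `&` dia e prec2 b <= dia e prec2 (a `&` b).
Proof.
split=> [p2 a b|le12 a b c /(dia_leP H2) abc x /(le_boxP H1) xa].
  apply/(le_diaP H2) => c abc; apply: closeds_le => k kc.
  rewrite lexI => /andP[/(closed_le_box H1 kc) [x xa kx] kb].
  have [y [/(dia_leP H2) b_y xyc]] := p2 a b c abc x xa.
  apply: (@le_trans _ _ (e (x `&` y))); last by rewrite (canext_embedding He).
  by rewrite canext_meet lexI kx (le_trans kb b_y).
have [|y b_y xyc] := @meet_dia_le _ H2 x b c; last by exists y.
by apply: le_trans abc; apply: le_trans (le12 a b); apply: leI2.
Qed.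

Lemma comp_comm_correspondence :
  rel_sub (rel_comp prec2 prec1) (rel_comp prec1 prec2) <->
  forall a, diaS e prec1 (box e prec2 a) <= boxP e prec2 (dia e prec1 a).
Proof.
split=> [sub a|le12 b c [a /(le_boxP H2) ba /(dia_leP H1) ac]].
  apply: diaS_le => k kc /(closed_le_box H2 kc) [b ba kb]; exists b => //.
  apply: le_boxP_ext => o oo /(dia_le_open H1 oo) [c ac co]; exists c => //.
  have [|z /(dia_leP H1) bz /(le_boxP H2) zc] := sub b c; first by exists a.
  exact: le_trans zc.
(* The diamond is closed and the box is open, so compactness interpolates an element [z] of [A]
   between them. *)
have /(dia_le_open H1 (box_open H2 c)) [z bz /(le_boxP H2) zc] :
    dia e prec1 b <= box e prec2 c.
  apply: le_trans (dia_le_diaS H1 ba) (le_trans (le12 a) _).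
  exact: boxP_le_box.
by exists z.
Qed.

(** As [dia e prec1 a] is closed, the inequality unfolds to [dia e prec1 a <= dia e prec2 b]
    whenever [prec1 a b]. *)
Lemma comp_sub_correspondence : rel_sub (rel_comp prec1 prec2) prec1 <->
  forall a, dia e prec1 a <= diaS e prec2 (dia e prec1 a).
Proof.
split=> [sub a|le12 a c [b /(dia_leP H1) ab /(dia_leP H2) bc]].
  apply/(le_diaS_closed _ _ (dia_closed H1 a)) => b /(dia_leP H1) ab.
  by apply/(le_diaP H2) => c bc; apply/(dia_leP H1)/sub; exists b.
apply/(dia_leP H1); apply: le_trans bc.
by move/(le_diaS_closed _ _ (dia_closed H1 a)): (le12 a); apply.
Qed.

Lemma join_top_correspondence :
  (forall a b, prec1 a b -> prec2 a b -> b = \top) <->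
  forall a, dia e prec1 a `|` dia e prec2 a = \top.
Proof.
split=> [top a|top a b /(dia_leP H1) ab1 /(dia_leP H2) ab2].
  apply/le_anti; rewrite lex1 /=; apply: le_opens => o oo.
  rewrite leUx => /andP[/(dia_le_open H1 oo) [b ab bo]].
  move=> /(dia_le_open H2 oo) [c ac co].
  (* By (WO) the join of [b] and [c] is a successor of [a] for both relations, hence [\top]. *)
  rewrite -canext_top -(top a (b `|` c)) ?canext_join ?leUx ?bo //.
    exact: (sub_WO H1) ab (leUl _ _).
  exact: (sub_WO H2) ac (leUr _ _).
apply/le_anti; rewrite lex1 /= -(canext_embedding He) canext_top -(top a).
by rewrite leUx ab1.
Qed.

(** By (SI), being a successor of every element amounts to being a successor of [\top]. *)
Lemma top_correspondence :
  (forall b, (forall a, prec1 a b) -> forall a, prec2 a b) <->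
  dia e prec2 \top <= dia e prec1 \top.
Proof.
split=> [sub|le21 b ab a].
  apply/(le_diaP H1) => b tb; apply/(dia_leP H2); apply: sub => a.
  exact: (sub_SI H1) (lex1 a) tb.
apply: (sub_SI H2) (lex1 a) _; apply/(dia_leP H2); apply: le_trans le21 _.
exact/(dia_leP H1).
Qed.

(** As [box e prec2 \bot] is open, its image under [boxP] is the join of the [box e prec1 b] with
    [prec2 b \bot]. *)
Lemma bot_correspondence :
  (forall a, (exists b, prec1 a b /\ prec2 b \bot) -> a = \bot) <->
  boxP e prec1 (box e prec2 \bot) = \bot.
Proof.
split=> [bot|bot a [b [/(le_boxP H1) ab /(le_boxP H2) bbot]]].
  apply/le_anti; rewrite le0x andbT.
  apply/(boxP_open_le _ _ (box_open H2 \bot)) => b /(le_boxP H2) bbot.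
  apply/(box_leP H1) => a ab.
  by rewrite (bot a) ?canext_bot //; exists b.
apply/le_anti; rewrite le0x andbT -(canext_embedding He) canext_bot -bot.
apply: le_trans ab _; move: b bbot.
exact/(boxP_open_le _ _ (box_open H2 \bot)).
Qed.

End Correspondences.
End CanonicalExtensionTheory.

Theorem proposition5p5 (d d' : Order.disp_t)
    (A : tbLatticeType d) (prec1 prec2 : A -> A -> Prop)
    (D : tbLatticeType d') (e : A -> D)
    (Hprec : bisubordination prec1 prec2) (He : canonical_extension e) :
  (rel_sub prec1 prec2 <->
     forall a : A, dia e prec2 a <= dia e prec1 a) /\
  (rel_sub (rel_comp prec2 prec1) (fun x y : A => x <= y) <->
     forall a : A, box e prec2 a <= dia e prec1 a) /\
  (right_distributive (@Order.meet d A) (@Order.join d A) ->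
     (P1 prec1 prec2 <->
        forall a b : A,
          box e prec1 (a `|` b) <= dia e prec2 a `|` box e prec1 b) /\
     (P2 prec1 prec2 <->
        forall a b : A,
          box e prec1 a `&` dia e prec2 b <= dia e prec2 (a `&` b))) /\
  (rel_sub (rel_comp prec2 prec1) (rel_comp prec1 prec2) <->
     forall a : A,
       diaS e prec1 (box e prec2 a) <= boxP e prec2 (dia e prec1 a)) /\
  (rel_sub (rel_comp prec1 prec2) prec1 <->
     forall a : A, dia e prec1 a <= diaS e prec2 (dia e prec1 a)) /\
  ((forall a b : A, prec1 a b -> prec2 a b -> b = \top) <->
     forall a : A, dia e prec1 a `|` dia e prec2 a = \top) /\
  ((forall b : A, (forall a : A, prec1 a b) -> forall a : A, prec2 a b) <->
     dia e prec2 \top <= dia e prec1 \top) /\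
  ((forall a : A, (exists b : A, prec1 a b /\ prec2 b \bot) -> a = \bot) <->
     boxP e prec1 (box e prec2 \bot) = \bot).
Proof.
have [H1 H2] := Hprec.
split; first exact: rel_sub_correspondence.
split; first exact: comp_sub_le_correspondence.
split; first by split; [exact: P1_correspondence | exact: P2_correspondence].
split; first exact: comp_comm_correspondence.
split; first exact: comp_sub_correspondence.
split; first exact: join_top_correspondence.
split; first exact: top_correspondence.
exact: bot_correspondence.
Qed.
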